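(* Let $V$ be a finite set and let $\mathcal{B}\subseteq 2^V$ be a Sperner hypergraph. Then the pure Horn function $h=\Phi_\mathcal{B}$ is the only pure Horn function $h:\{0,1\}^V\to\{0,1\}$ with $\mathcal{K}(h)=\mathcal{B}$ if and only if for all $T\in\mathcal{B}^d$ and all $v\in V\setminus T$ there exists $T'\in\mathcal{B}^d$ such that $T'\neq T$ and $T'\subseteq T\cup\{v\}$.
   Context: $V$ is a finite set of Boolean variables. A pure Horn clause is written as an implication $A\to v$ with $A\subseteq V$, $v\in V$; it stands for the clause $v\vee\bigvee_{a\in A}\bar a$. A Boolean function $h:\{0,1\}^V\to\{0,1\}$ is pure Horn if it can be represented by a conjunction of pure Horn clauses. A clause $A\to v$ is an implicate of $h$ if every $x$ with $h(x)=1$ satisfies $A\to v$. A set $K\subseteq V$ is a key of $h$ if $K\to v$ is an implicate of $h$ for all $v\in V\setminus K$; $\mathcal{K}(h)$ denotes the family of inclusion-wise minimal keys of $h$. A hypergraph $\mathcal{B}\subseteq 2^V$ is Sperner if no hyperedge contains another. A transversal of $\mathcal{B}$ is a set $T\subseteq V$ meeting every hyperedge; $\mathcal{B}^d$ is the family of inclusion-wise minimal transversals. For a Sperner hypergraph $\mathcal{B}$, $\Phi_\mathcal{B}=\bigwedge_{B\in\mathcal{B}}\bigwedge_{v\in V\setminus B}(B\to v)$ (it satisfies $\mathcal{K}(\Phi_\mathcal{B})=\mathcal{B}$). *)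

(* Defs.v *)
From HB Require Import structures.
From mathcomp Require Import all_boot.

Set Implicit Arguments.
Unset Strict Implicit.
Unset Printing Implicit Defensive.

Section HornFunctions.

Variable V : finType.

(* Points of {0,1}^V, and Boolean functions on them; both are finite functions,
   so that Leibniz equality of Boolean functions is pointwise equality. *)
Definition point := {ffun V -> bool}.
Definition boolfun := {ffun point -> bool}.

(* The pair (A, v) encodes the pure Horn clause A -> v.  Tautological clauses,
   those with v \in A, are allowed. *)
Definition clause := ({set V} * V)%type.

Definition satisfies (x : point) (c : clause) : bool :=
  x c.2 || [exists a in c.1, ~~ x a].

(* The empty conjunction is the constant function 1. *)
Definition conj_clauses (C : {set clause}) : boolfun :=
  [ffun x : point => [forall c in C, satisfies x c]].

Definition pure_horn (h : boolfun) : Prop :=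
  exists C : {set clause}, h = conj_clauses C.

Definition implicate (h : boolfun) (c : clause) : bool :=
  [forall x, h x ==> satisfies x c].

Definition key (h : boolfun) (K : {set V}) : bool :=
  [forall v in ~: K, implicate h (K, v)].

Definition minimal_keys (h : boolfun) : {set {set V}} :=
  [set K | minset (key h) K].

Definition sperner (B : {set {set V}}) : Prop :=
  forall E F, E \in B -> F \in B -> E \subset F -> E = F.

Definition transversal_of (B : {set {set V}}) (T : {set V}) : bool :=
  [forall E in B, T :&: E != set0].

Definition minimal_transversals (B : {set {set V}}) : {set {set V}} :=
  [set T | minset (transversal_of B) T].

Definition Phi (B : {set {set V}}) : boolfun :=
  conj_clauses [set c : clause | (c.1 \in B) && (c.2 \in ~: c.1)].

End HornFunctions.

(* Main.v *)
(** The true points of a pure Horn function, read as subsets of V, are closed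
    under intersection, and a set is a key iff V is the only true set
    containing it.  If the minimal keys of h are B, the true sets of h are among
    those of [Phi B], which are V and the complements of the transversals of B;
    moreover the complement of each minimal transversal is true for h, being a
    maximal non-key.  Hence h = Phi B is forced as soon as every transversal
    is a union of minimal ones, and the exchange condition on T and v says that
    [T :|: [set v]] is such a union.  If it fails for T and v, the single true set
    [~: (T :|: [set v])] can be removed from [Phi B] without changing the keys. *)
Require Import Defs.
From mathcomp Require Import all_boot.

Section PureHornFunctions.

Variable V : finType.
Implicit Types (x : point V) (h : boolfun V) (B : {set {set V}}).
Implicit Types (C : {set clause V}) (E K T X : {set V}) (v : V).

Definition support x : {set V} := [set a | x a].
Definition indicator X : point V := [ffun a => a \in X].

Lemma support_indicator X : support (indicator X) = X.
Proof. by apply/setP => a; rewrite inE ffunE. Qed.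

Lemma satisfiesE x (c : clause V) :
  satisfies x c = (c.1 \subset support x) ==> (c.2 \in support x).
Proof.
rewrite /satisfies inE implybE orbC; congr (_ || _).
apply/existsP/subsetPn => [[a /andP[ca xa]] | [a ca xa]]; exists a => //.
  by rewrite inE.
by rewrite ca; rewrite inE in xa.
Qed.

Lemma conj_clausesP C x :
  reflect (forall c, c \in C -> c.1 \subset support x -> c.2 \in support x)
          (conj_clauses C x).
Proof.
rewrite ffunE; apply: (iffP forall_inP) => H c /H; rewrite satisfiesE.
  by move/implyP.
by move/implyP.
Qed.

(** The clauses of [Phi B] with body [E] jointly force every variable outside [E]. *)
Lemma PhiP B x :
  reflect (forall E, E \in B -> E \subset support x -> support x = setT)
          (Phi B x).
Proof.
apply: (iffP (conj_clausesP _ _)) => [H E EB Ex | H [E v]].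
  apply/setP => v; rewrite [RHS]inE.
  have [vE | vE] := boolP (v \in E); first exact: (subsetP Ex).
  by apply: (H (E, v)); rewrite // inE /= EB inE.
by rewrite inE /= => /andP[EB _] Ex; rewrite (H E).
Qed.

Lemma keyP h K :
  reflect (forall x, h x -> K \subset support x -> support x = setT) (key h K).
Proof.
apply: (iffP forall_inP) => [H x hx Kx | H v vK].
  apply/setP => v; rewrite [RHS]inE.
  have [vK | vK] := boolP (v \in K); first exact: (subsetP Kx).
  have /H/forallP/(_ x) : v \in ~: K by rewrite inE.
  by rewrite hx satisfiesE /= Kx.
apply/forallP => x; apply/implyP => hx; rewrite satisfiesE /=.
by apply/implyP => Kx; rewrite (H x hx Kx).
Qed.

Lemma key_setT h : key h setT.
Proof. by apply/keyP => x _; rewrite subTset => /eqP. Qed.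

Lemma key_superset_minimal {h K} :
  key h K -> exists2 E, E \in minimal_keys h & E \subset K.
Proof. by case/minset_exists => E minE EK; exists E; rewrite ?inE. Qed.

Lemma minimal_keys_key {h E} : E \in minimal_keys h -> key h E.
Proof. by rewrite inE => /minsetp. Qed.

Lemma minimal_keys_sperner h B :
  sperner B ->
  (forall E, E \in B -> key h E) ->
  (forall K, key h K -> exists2 E, E \in B & E \subset K) ->
  minimal_keys h = B.
Proof.
move=> spB keyB Bkey; apply/setP => K; rewrite inE.
apply/idP/idP => [minK | KB].
  have [E EB EK] := Bkey K (minsetp minK).
  by rewrite -(minsetinf minK (keyB E EB) EK).
apply/minsetP; split=> [|K' keyK' K'K]; first exact: keyB.
have [E EB EK'] := Bkey K' keyK'.
(* [E] lies in [K'], hence in [K]; the Sperner property collapses this chain. *)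
have EK := spB _ _ EB KB (subset_trans EK' K'K).
by apply/eqP; rewrite eqEsubset K'K -EK.
Qed.

Lemma transversalCP B X :
  reflect (forall E, E \in B -> ~~ (E \subset X)) (transversal_of B (~: X)).
Proof.
by apply: (iffP forall_inP) => H E /H; rewrite setIC -setDE setD_eq0.
Qed.

Lemma transversal_superset_minimal {B T} :
  transversal_of B T ->
  exists2 T', T' \in minimal_transversals B & T' \subset T.
Proof. by case/minset_exists => T' minT T'T; exists T'; rewrite ?inE. Qed.

Lemma Phi_transversalC B T : transversal_of B T -> Phi B (indicator (~: T)).
Proof.
rewrite -{1}(setCK T) => /transversalCP trT; apply/PhiP => E EB.
by rewrite support_indicator (negPf (trT E EB)).
Qed.

Lemma key_Phi B E : E \in B -> key (Phi B) E.
Proof. by move=> EB; apply/keyP => x /PhiP/(_ E EB). Qed.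

(* Only minimal transversals are tested: their complements are the maximal
   sets that contain no member of B. *)
Lemma key_superset h B K :
  B != set0 ->
  (forall T, T \in minimal_transversals B -> K \subset ~: T ->
     exists2 x, h x & ~: T \subset support x /\ support x != setT) ->
  key h K -> exists2 E, E \in B & E \subset K.
Proof.
move=> B0 witness /keyP keyK.
have [/exists_inP // | noE] := boolP [exists E in B, E \subset K].
have trK : transversal_of B (~: K).
  by apply/transversalCP => E EB; apply: contra noE => EK; apply/exists_inP; exists E.
have [T minT TK] := transversal_superset_minimal trK.
have KT : K \subset ~: T by rewrite subsetC.
have [x hx [Tx /eqP[]]] := witness T minT KT.
exact: keyK hx (subset_trans KT Tx).
Qed.

Lemma minimal_transversal_proper B T :
  B != set0 -> T \in minimal_transversals B -> ~: T != setT.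
Proof.
case/set0Pn => E EB; rewrite inE => /minsetp/forall_inP/(_ E EB).
case/set0Pn => a /setIP[aT _]; apply: contraTneq aT => /setP/(_ a).
by rewrite !inE => ->.
Qed.

Lemma minimal_keys_Phi B :
  sperner B -> B != set0 -> minimal_keys (Phi B) = B.
Proof.
move=> spB B0; apply: minimal_keys_sperner => // [E | K]; first exact: key_Phi.
apply: key_superset => // T minT _; exists (indicator (~: T)).
  by apply: Phi_transversalC; move: minT; rewrite inE => /minsetp.
by rewrite support_indicator (minimal_transversal_proper B).
Qed.

(** Since [~: T] contains no minimal key, some true point of [h] lies above it and misses a
    variable. The complement of its support is a transversal inside [T], so it is [T] by
    minimality. *)
Lemma minimal_transversalC_true h B T :
  minimal_keys h = B -> T \in minimal_transversals B -> h (indicator (~: T)).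
Proof.
move=> keyhB; rewrite inE => minT.
have : ~~ key h (~: T).
  apply/negP => /key_superset_minimal[E]; rewrite keyhB => EB.
  move: (minsetp minT); rewrite -{1}(setCK T) => /transversalCP/(_ E EB).
  by move/negPf->.
case/forall_inPn => v; rewrite setCK => vT /forallPn[x].
rewrite negb_imply satisfiesE /= negb_imply => /and3P[hx Tx vx].
have trx : transversal_of B (~: support x).
  apply/transversalCP => E EB; apply: contra vx => Ex.
  rewrite -keyhB in EB.
  by have /keyP/(_ x hx Ex)-> := minimal_keys_key EB.
suff -> : indicator (~: T) = x by [].
rewrite -(minsetinf minT trx) ?setCK 1?subsetC //; last by rewrite subCset.
by apply/ffunP => a; rewrite !ffunE inE.
Qed.

(** If a minimal [T0] inside [T] misses [v], exchange it at [v]. The resulting [T'] contains [v]: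
    otherwise it would lie in [T0] and equal it. *)
Lemma transversal_cover B :
  (forall T v, T \in minimal_transversals B -> v \notin T ->
     exists T', [/\ T' \in minimal_transversals B, T' != T
                  & T' \subset T :|: [set v]]) ->
  forall T v, transversal_of B T -> v \in T ->
  exists T', [/\ T' \in minimal_transversals B, v \in T' & T' \subset T].
Proof.
move=> exchange T v trT vT.
have [T0 minT0 T0T] := transversal_superset_minimal trT.
have [vT0 | vT0] := boolP (v \in T0); first by exists T0.
have [T' [minT' T'T0 sub]] := exchange T0 v minT0 vT0.
exists T'; split=> //; last first.
  by apply: subset_trans sub _; rewrite subUset T0T sub1set.
apply: contraNT T'T0 => vT'; apply/eqP.
rewrite !inE in minT0 minT'; apply: (minsetinf minT0 (minsetp minT')).
apply/subsetP => a aT'; have := subsetP sub a aT'.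
by rewrite !inE => /orP[//|/eqP av]; rewrite -av aT' in vT'.
Qed.

Lemma Phi_unique h B :
  (forall T v, T \in minimal_transversals B -> v \notin T ->
     exists T', [/\ T' \in minimal_transversals B, T' != T
                  & T' \subset T :|: [set v]]) ->
  pure_horn h -> minimal_keys h = B -> h = Phi B.
Proof.
move=> exchange [C hC] keyhB; apply/ffunP => x.
apply/idP/idP => [hx | /PhiP Phix].
  apply/PhiP => E; rewrite -keyhB => /minimal_keys_key/keyP keyE.
  exact: keyE.
rewrite hC; apply/conj_clausesP => -[A u] /= cC Ax.
apply/negPn/negP => ux.
have trx : transversal_of B (~: support x).
  by apply/transversalCP => E EB; apply: contra ux => /(Phix E EB)->.
have ux' : u \in ~: support x by rewrite inE.
(* If [x] violates [A -> u], so does the larger set [~: T], which is a true set of [h]. *)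
have [T [minT uT Tx]] := transversal_cover _ exchange _ _ trx ux'.
have := minimal_transversalC_true _ _ _ keyhB minT.
rewrite hC => /conj_clausesP/(_ _ cC) /=.
by rewrite support_indicator inE uT (subset_trans Ax) 1?subsetC // => /(_ isT).
Qed.

Lemma exchange_of_unique B T v :
  sperner B -> B != set0 ->
  (forall h, pure_horn h -> minimal_keys h = B -> h = Phi B) ->
  T \in minimal_transversals B -> v \notin T ->
  exists T', [/\ T' \in minimal_transversals B, T' != T
               & T' \subset T :|: [set v]].
Proof.
move=> spB B0 unique minT vT.
have [/existsP[T' /and3P] | noT'] := boolP [exists T' : {set V},
  [&& T' \in minimal_transversals B, T' != T & T' \subset T :|: [set v]]].
  by exists T'.
(* The extra clause [N -> v] is violated at [N] itself. *)
pose N := ~: (T :|: [set v]).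
pose CB : {set clause V} := [set c | (c.1 \in B) && (c.2 \in ~: c.1)].
pose h := conj_clauses ((N, v) |: CB).
have hE x : h x = Phi B x && ((N \subset support x) ==> (v \in support x)).
  apply/conj_clausesP/andP => [H | [/conj_clausesP H /implyP Nv] c].
    split; last by apply/implyP; apply: (H (N, v)); rewrite !inE eqxx.
    by apply/conj_clausesP => c cCB; apply: H; rewrite inE cCB orbT.
  by rewrite inE => /orP[|/H //]; rewrite inE => /eqP->.
have keyh : minimal_keys h = B.
  apply: minimal_keys_sperner => // [E EB | K].
    by apply/keyP => x; rewrite hE => /andP[/PhiP/(_ E EB)].
  apply: key_superset => // T0 minT0 _; exists (indicator (~: T0)); last first.
    by rewrite support_indicator (minimal_transversal_proper B).
  rewrite hE Phi_transversalC; last by move: minT0; rewrite inE => /minsetp.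
  rewrite support_indicator setCS; apply/implyP => T0sub; rewrite inE.
  (* If [~: T0] violated [N -> v], then [T0] would be the excluded exchange partner, distinct from
     [T] because it contains [v]. *)
  apply: contra noT' => vT0; apply/existsP; exists T0; rewrite minT0 T0sub andbT.
  by apply: contraNneq vT => <-.
(* [T :|: [set v]] is still a transversal, so [Phi B] holds at [N] where [h] fails. *)
have : Phi B (indicator N).
  apply: Phi_transversalC; rewrite inE in minT.
  apply/forall_inP => E EB.
  have /forall_inP/(_ E EB) := minsetp minT.
  by rewrite -!subset0; apply: contra; apply: subset_trans; apply: setSI; apply: subsetUl.
rewrite -(unique h (ex_intro _ _ erefl) keyh) hE support_indicator subxx.
by rewrite !inE eqxx orbT andbF.
Qed.

End PureHornFunctions.

(** [hVB] excludes only the case of [V] and [B] both empty: there the exchange condition is vacuous,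
    while no function has an empty family of minimal keys. *)
Theorem theorem1 (V : finType) (B : {set {set V}}) (hB : sperner B)
    (hVB : (0 < #|V|) || (B != set0)) :
  ((pure_horn (Phi B) /\ minimal_keys (Phi B) = B) /\
   (forall h : boolfun V, pure_horn h -> minimal_keys h = B -> h = Phi B))
  <->
  (forall (T : {set V}) (v : V),
     T \in minimal_transversals B -> v \notin T ->
     exists T' : {set V},
       [/\ T' \in minimal_transversals B, T' != T & T' \subset T :|: [set v]]).
Proof.
split=> [[[_ keyB] unique] T v | exchange].
  apply: exchange_of_unique => //; apply/set0Pn.
  (* [setT] is always a key, so a minimal key exists. *)
  have [E] := key_superset_minimal _ (key_setT _ (Phi B)).
  by rewrite keyB; exists E.
have B0 : B != set0.
  case/orP: hVB => // /card_gt0P[v _]; apply/negP => /eqP B0.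
  (* The empty hypergraph has set0 as its only minimal transversal. *)
  have min0 : set0 \in minimal_transversals B.
    rewrite inE; apply/minsetP; split=> [|T _]; last by rewrite subset0 => /eqP.
    by apply/forall_inP => E; rewrite B0 inE.
  have [|T [minT /negP T0 _]] := exchange set0 v min0; first by rewrite inE.
  rewrite inE in minT; rewrite inE in min0; apply: T0.
  by rewrite eq_sym (minsetinf minT (minsetp min0) (sub0set T)).
split; last by move=> h; exact: Phi_unique.
split; last exact: minimal_keys_Phi.
by exists [set c : clause V | (c.1 \in B) && (c.2 \in ~: c.1)].
Qed.
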